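(* For any $n\in\mathbb{Z}$ with $n\geq 2$, $h(\mathrm{Q}_{4n})=n^2=|\mathrm{Q}_{4n}'|^2$.
   Context: For a finite group $G$ with conjugacy classes $K_1,\dots,K_s$ and irreducible complex characters $\chi_1,\dots,\chi_s$, Harada's number is $h(G)=\frac{|K_1|\cdots|K_s|}{\chi_1(1)\cdots\chi_s(1)}$. $G'$ denotes the commutator subgroup of $G$. The generalized quaternion group is $\mathrm{Q}_{4n}=\langle\sigma,\tau\mid\sigma^{2n}=1,\ \sigma^n=\tau^2,\ \sigma^\tau=\sigma^{-1}\rangle$, where $y^x=x^{-1}yx$. *)

(* Defs.v *)
From mathcomp Require Import all_boot all_order all_algebra.
From mathcomp Require Import all_fingroup all_solvable all_field all_character.

Set Implicit Arguments.
Unset Strict Implicit.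
Unset Printing Implicit Defensive.

Import GRing.Theory.

Local Open Scope ring_scope.

Definition harada_number (gT : finGroupType) (G : {group gT}) : algC :=
  (\prod_(K in classes G) #|K|%:R) / (\prod_(i : Iirr G) 'chi_i 1%g).

(* [G \isog Grp (...)] says that G is the largest finite quotient of the      *)
(* presented group; that group is finite here (every element is s^i t^j with  *)
(* i < 2n and j < 2), so G is a copy of it. MathComp's 'Q_m is no substitute, *)
(* being the generalized quaternion group only when m is a power of 2.        *)
Definition generalized_quaternion (n : nat) (gT : finGroupType)
    (G : {group gT}) : Prop :=
  (G \isog Grp (s : t : s ^+ (2 * n) = 1, s ^+ n = t ^+ 2, s ^ t = s^-1))%g.

(* Main.v *)
Require Import Defs.
From mathcomp Require Import all_boot all_order all_algebra.
From mathcomp Require Import all_fingroup all_solvable all_field all_character.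

Set Implicit Arguments.
Unset Strict Implicit.
Unset Printing Implicit Defensive.

Local Open Scope ring_scope.

Import Order.TTheory GRing.Theory Num.Theory.

(** The numerator and the denominator of Harada's number are both governed by
    the cyclic subgroup S = <s> of order 2n: it has index 2, and every element
    of G outside S inverts it.

    - Classes. Inside S the class of x is {x, x^-1}, so the two solutions 1 and
      s^n of x^2 = 1 are central and the other 2n - 2 elements of S form n - 1
      classes of size 2. Outside S the class of x is the coset <s^2> x, so the
      2n elements of G \ S form two classes of size n. The class sizes multiply
      to 2^(n-1) n^2 ([prod_card_classes_inverted_cycle]).
    - Characters. S is abelian of index 2, so all irreducible degrees are 1 or
      2. The derived subgroup is <s^2>, of order n and index 4, so there are
      4 linear characters; as the squares of the degrees add up to 4n, there
      are n - 1 characters of degree 2. The degrees multiply to 2^(n-1)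
      ([prod_irr1_abelian_index2]).

    The quotient is n^2. What remains is to see that the presentation does not
    collapse, that is, that s really has order 2n. The relations show that the
    group has order at most 4n; for the converse a group of order at least 4n
    satisfying them is obtained as a central quotient of the semidirect product
    of Z/2n by Z/4 with Z/4 acting by inversion
    ([generalized_quaternion_model]). *)

(** * Products of class sizes and of character degrees *)

(** If all classes inside a normal subset A have size m, there are |A| / m of
    them; the quotient is passed as k to avoid a division. *)
Lemma prod_card_classes_uniform (gT : finGroupType) (G : {group gT})
    (A : {set gT}) (m k : nat) :
  A \subset G -> (G \subset 'N(A))%g ->
  {in A, forall x, #|(x ^: G)%g| = m} -> (0 < m)%N -> #|A| = (k * m)%N ->
  (\prod_(K in classes G | K \subset A) #|K| = m ^ k)%N.
Proof.
move=> sAG nAG classA m_gt0 oA; pose P := [set K in classes G | K \subset A].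
have clP K : K \in P -> exists2 x, x \in A & K = (x ^: G)%g.
  rewrite inE => /andP[/imsetP[x Gx ->]]; rewrite class_sub_norm // => Ax.
  by exists x.
have partP : partition P A.
  apply/and3P; split.
  - apply/eqP/setP=> x; apply/bigcupP/idP => [[K] | Ax].
      by rewrite inE => /andP[_ /subsetP sKA] /sKA.
    exists (x ^: G)%g; last exact: class_refl.
    by rewrite inE mem_classes ?(subsetP sAG) //= class_sub_norm.
  - case/and3P: (classes_partition G) => _ tiG _; apply: trivIsetS tiG.
    by apply/subsetP => K; rewrite inE => /andP[].
  by apply/negP => /clP[x _ /setP/(_ x)]; rewrite inE class_refl.
have uniP : {in P, forall K : {set gT}, #|K| = m}.
  by move=> K /clP[x Ax ->]; apply: classA.
have := card_uniform_partition uniP partP.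
rewrite oA => /eqP; rewrite eqn_pmul2r // => /eqP ->.
rewrite -prod_nat_const; apply: eq_big => [K | K]; first by rewrite inE.
by move=> PK; apply: uniP; rewrite inE.
Qed.

(** By Frobenius reciprocity an irreducible character of G is a constituent of a
    character induced from an irreducible one of A, which is linear; the
    induced character has degree |G : A|. *)
Lemma irr1_le_index_abelian (gT : finGroupType) (G A : {group gT})
    (i : Iirr G) :
  A \subset G -> abelian A -> 'chi_i 1%g <= #|G : A|%g%:R.
Proof.
move=> sAG abA; have [j Aj] := constt_cfRes_irr A i.
rewrite -constt_Ind_Res in Aj.
apply: le_trans (char1_ge_constt (cfInd_char G (irr_char j)) Aj) _.
by rewrite cfInd1 // lin_char1 ?mulr1 //; apply/char_abelianP.
Qed.

(** All degrees are 1 or 2 and exactly |G : G'| of them are 1, so the sum of the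
    squares of the degrees, which is |G|, determines the number k of
    characters of degree 2. *)
Lemma prod_irr1_abelian_index2 (gT : finGroupType) (G A : {group gT})
    (k : nat) :
  A \subset G -> abelian A -> #|G : A|%g = 2%N ->
  #|G| = (#|G : G^`(1)|%g + k * 4)%N ->
  \prod_(i : Iirr G) 'chi_i 1%g = (2 ^ k)%:R.
Proof.
move=> sAG abA iA oG; pose lin := [pred i : Iirr G | 'chi_i \is a linear_char].
have deg1 i : lin i -> 'chi_i 1%g = 1 by apply: lin_char1.
have deg2 i : ~~ lin i -> 'chi_i 1%g = 2%:R.
  move=> nlin; have := irr1_le_index_abelian i sAG abA; rewrite iA.
  have := irr1_gt0 i; have := nlin.
  rewrite inE qualifE/= irr_char /= irr1_degree pnatr_eq1 ltr0n ler_nat.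
  by move: (irr_degree _) => [|[|[|d]]].
have card_nlin : #|[predC lin]| = k.
  have := irr_sum_square G; rewrite (bigID lin) /=.
  rewrite (eq_bigr (fun=> 1)) => [|i /deg1 ->]; last by rewrite expr1n.
  rewrite [X in _ + X](eq_bigr (fun=> 4%:R)); last first.
    by move=> i /deg2 ->; rewrite -natrX.
  rewrite !sumr_const card_lin_irr oG -mulrnA -natrD => /eqP.
  by rewrite eqr_nat eqn_add2l mulnC eqn_pmul2r // => /eqP.
rewrite (bigID lin) /= big1 // mul1r (eq_bigr (fun=> 2%:R)) //.
by rewrite prodr_const -natrX card_nlin.
Qed.

Local Open Scope group_scope.

(** * A group of order at least 4n satisfying the relations *)

(** In the semidirect product B = <x> ><| <y> of order 8n, where y has order 4
    and inverts x, the element z = x^n y^2 is a central involution; killing it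
    imposes the missing relation x^n = y^2 (as y^2 = y^-2) and at most halves
    the order. *)
Lemma generalized_quaternion_model (n : nat) : (2 <= n)%N ->
  exists (gT : finGroupType) (H : {group gT}), (4 * n <= #|H|)%N /\
    H \homg Grp (s : t : s ^+ (2 * n) = 1, s ^+ n = t ^+ 2, s ^ t = s^-1).
Proof.
move=> n_gt1; have q_gt1 : (1 < 2 * n)%N by rewrite mul2n -addnn ltn_addr.
have oB := card_ext_dihedral q_gt1 (isT : 1 < 4)%N isT.
have := isoGrp_hom (Grp_ext_dihedral q_gt1 (isT : 1 < 4)%N isT).
move: (Extremal.gtype _ _ _) oB => gT; set B := [set: gT] => oB.
case/existsP=> -[x y] /= /eqP[defB xq y4 xy].
pose z := x ^+ n * y ^+ 2.
have xn2 : x ^+ n * x ^+ n = 1 by rewrite -expgD addnn -mul2n.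
have cxy2 : commute x (y ^+ 2).
  by apply/commgP/conjg_fixP; rewrite expgS conjgM xy conjVg xy invgK.
have cxny : commute (x ^+ n) y.
  apply/commgP/conjg_fixP; rewrite conjXg xy expgVn.
  by apply/eqP; rewrite eq_invg_mul xn2.
have z2 : z ^+ 2 = 1.
  rewrite expgMn; last exact/commute_sym/commuteX/commute_sym.
  by rewrite -!expgM mulnC xq y4 mulg1.
have nzB : B \subset 'N(<[z]>).
  apply: cents_norm; rewrite cent_cycle -[B]defB join_subG !cycle_subG.
  apply/andP; split; apply/cent1P; apply: commuteM => //.
    exact: commuteX.
  exact: commuteX.
have [Bx By] : x \in B /\ y \in B by rewrite !inE.
have [Nx Ny] : x \in 'N(<[z]>) /\ y \in 'N(<[z]>).
  by split; apply: (subsetP nzB).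
exists _, (B / <[z]>)%G; split.
  have o_z : (#[z] <= 2)%N by rewrite dvdn_leq // order_dvdn z2.
  rewrite card_quotient // -(leq_pmul2r (order_gt0 z)).
  rewrite [leqRHS]mulnC Lagrange ?subsetT // oB.
  by rewrite (leq_trans (leq_mul (leqnn _) o_z)) //= -mul2n mulnC !mulnA.
apply/existsP; exists (coset <[z]> x, coset <[z]> y); rewrite /= !xpair_eqE.
rewrite -!morphX // -morphJ // -morphV // xq xy morph1 !eqxx !andbT.
rewrite -!quotient_cycle // -quotientY ?cycle_subG // defB eqxx /=.
have def_x : x ^+ n = z * y ^- 2 by rewrite /z mulgK.
have y2V : y ^- 2 = y ^+ 2 by apply/eqP; rewrite eq_invg_mul -expgD y4.
by rewrite def_x y2V coset_kerl ?cycle_id.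
Qed.

(** * Groups with an inverted cyclic subgroup of index 2 *)

(** The hypotheses cover the dihedral groups of order 4n along with the
    generalized quaternion groups: neither the class sizes nor the character
    degrees depend on the value of t ^+ 2. *)
Section InvertedCycle.

Variables (n : nat) (gT : finGroupType) (G : {group gT}) (s t : gT).
Hypotheses (n_gt0 : (0 < n)%N) (os : #[s] = (2 * n)%N).
Hypotheses (Gs : s \in G) (iS : #|G : <[s]>| = 2%N).
Hypotheses (Gt : t \in G) (S't : t \notin <[s]>) (st : s ^ t = s^-1).

Let sSG : <[s]> \subset G. Proof. by rewrite cycle_subG. Qed.
Let nsSG : <[s]> <| G. Proof. exact: index2_normal. Qed.
Let nSG : G \subset 'N(<[s]>). Proof. by case/andP: nsSG. Qed.
Let oG : #|G| = (4 * n)%N.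
Proof. by rewrite -(Lagrange sSG) iS -orderE os mulnAC. Qed.

Lemma conj_in_cycle x y : x \in <[s]> -> y \in <[s]> -> x ^ y = x.
Proof.
by move=> /cycleP[i ->] /cycleP[j ->]; apply/conjg_fixP/commgP/commuteX2.
Qed.

Lemma conj_notin_cycle x y : x \in <[s]> -> y \in G :\: <[s]> -> x ^ y = x^-1.
Proof.
have GSt : t \in G :\: <[s]> by rewrite inE S't.
move=> Sx; rewrite -(rcoset_index2 sSG iS GSt) => /rcosetP[u Su ->].
rewrite conjgM (conj_in_cycle Sx Su); case/cycleP: Sx => i ->.
by rewrite conjXg st expgVn.
Qed.

(** The commutator [s, t] is s^-2; modulo <s^2> the generators s and t of G
    commute. *)
Lemma der1_inverted_cycle : G^`(1) = <[s ^+ 2]>.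
Proof.
have nS2G : <[s ^+ 2]> <| G.
  by apply: char_normal_trans nsSG; apply: cycle_subgroup_char; apply: cycleX.
have [_ nS2] := andP nS2G.
have [Ns Nt] : s \in 'N(<[s ^+ 2]>) /\ t \in 'N(<[s ^+ 2]>).
  by split; apply: (subsetP nS2).
apply/eqP; rewrite eqEsubset cycle_subG andbC; apply/andP; split.
  rewrite (_ : s ^+ 2 = [~ s, t]^-1) ?groupV ?mem_commg //.
  by rewrite commgEl st invMg !invgK.
apply: der1_min => //.
have defG : <[s]> <*> <[t]> = G.
  apply/eqP; rewrite eqEsubset join_subG !cycle_subG Gs Gt /=.
  have GSt : t \in G :\: <[s]> by rewrite inE S't.
  rewrite -(setID G <[s]>) subUset subIset ?joing_subl ?orbT //=.
  rewrite -(rcoset_index2 sSG iS GSt).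
  apply/subsetP=> _ /rcosetP[u Su ->].
  by rewrite groupM // mem_gen // inE ?Su ?cycle_id ?orbT.
rewrite -defG quotientY ?cycle_subG // !quotient_cycle //.
rewrite abelianY !cycle_abelian /= cent_cycle cycle_subG.
apply/cent1P/commute_sym/commgP; rewrite -morphR //= coset_id //.
by rewrite commgEl st -invMg groupV cycle_id.
Qed.

Lemma card_der1_inverted_cycle : #|G^`(1)| = n.
Proof.
by rewrite der1_inverted_cycle -orderE orderXdiv os ?dvdn_mulr // mulKn.
Qed.

(** Conjugating x by s^-i multiplies it by s^(2i), which yields all of <s^2> x;
    conversely a class always stays within one coset of the derived
    subgroup. *)
Lemma class_notin_cycle x : x \in G :\: <[s]> -> x ^: G = <[s ^+ 2]> :* x.
Proof.
move=> GSx; have [Gx S'x] := setDP GSx; apply/eqP; rewrite eqEsubset.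
apply/andP; split; apply/subsetP=> y.
  case/imsetP=> g Gg ->; rewrite mem_rcoset -der1_inverted_cycle.
  rewrite (_ : x ^ g * x^-1 = [~ g, x^-1]); first by rewrite mem_commg ?groupV.
  by rewrite commgEl !conjgE invgK !mulgA.
case/rcosetP=> _ /cycleP[i ->] ->; apply/imsetP; exists (s ^- i).
  by rewrite groupV groupX.
have := conj_notin_cycle (mem_cycle s i) GSx.
rewrite !conjgE invgK => e.
rewrite (_ : x * s ^- i = s ^+ i * x).
  by rewrite mulgA -expgD -expgM mulnC muln2 addnn.
by rewrite -e !mulgA mulgV mul1g.
Qed.

Lemma class_in_cycle x : x \in <[s]> -> x ^: G = [set x; x^-1].
Proof.
move=> Sx; apply/setP=> y; rewrite !inE; apply/imsetP/orP.
  case=> g Gg ->; have [Sg | S'g] := boolP (g \in <[s]>); [left | right].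
    by rewrite conj_in_cycle.
  by rewrite conj_notin_cycle // inE S'g.
case=> /eqP->; [exists 1 | exists t]; rewrite ?group1 ?conjg1 //.
by rewrite conj_notin_cycle // inE S't.
Qed.

(** These turn out to be the elements of <[s]> equal to their inverses, which
    are those of its elements whose class is a singleton. *)
Let C := [set 1; s ^+ n].

Let card_C : #|C| = 2%N.
Proof.
rewrite cards2 eq_sym -order_dvdn os gtnNdvd //.
by rewrite mul2n -addnn -{1}(addn0 n) ltn_add2l.
Qed.

Let inv_fix x : x \in <[s]> -> (x == x^-1) = (x \in C).
Proof.
have s2n : s ^+ (2 * n) = 1 by rewrite -os expg_order.
case/cyclePmin => i lti ->; rewrite eq_sym eq_invg_mul -expgD -order_dvdn os.
rewrite addnn -mul2n dvdn_pmul2l // !inE; apply/idP/orP.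
  case/dvdnP=> k def_i; move: lti; rewrite os def_i ltn_pmul2r //.
  case: k {def_i} => [|[|k]] // _; [by left | right].
  by rewrite mul1n.
case=> [|/eqP sin].
  by rewrite -order_dvdn os; apply: dvdn_trans; rewrite dvdn_mull.
rewrite -(dvdn_pmul2l (isT : 0 < 2)%N) -os order_dvdn mulnC expgM sin.
by rewrite -expgM mulnC s2n.
Qed.

Lemma prod_card_classes_inverted_cycle :
  (\prod_(K in classes G) #|K| = 2 ^ n.-1 * n ^ 2)%N.
Proof.
have sCS : C \subset <[s]>.
  by apply/subsetP=> x /set2P[] ->; rewrite ?group1 ?mem_cycle.
have classC x : x \in C -> x ^: G = [set x].
  move=> Cx; have Sx := subsetP sCS x Cx.
  rewrite class_in_cycle //; move: Cx; rewrite -inv_fix // => /eqP <-.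
  by rewrite setUid.
have nCG : G \subset 'N(C).
  apply/cents_norm/centsP=> g Gg x Cx; apply/commute_sym/commgP/conjg_fixP.
  by apply/set1P; rewrite -classC // memJ_class.
have prodC : (\prod_(K in classes G | K \subset C) #|K| = 1 ^ 2)%N.
  apply: prod_card_classes_uniform => //.
    exact: subset_trans sCS sSG.
  by move=> x /classC ->; rewrite cards1.
have prodSC :
  (\prod_(K in classes G | K \subset <[s]> :\: C) #|K| = 2 ^ n.-1)%N.
  apply: prod_card_classes_uniform => //.
  - by rewrite subDset subsetU // sSG orbT.
  - by rewrite normsD.
  - move=> x /setDP[Sx C'x]; rewrite class_in_cycle // cards2.
    by rewrite inv_fix // C'x.
  by rewrite cardsD (setIidPr sCS) card_C -orderE os muln2 mul2n -subn1 doubleB.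
have prodGS :
  (\prod_(K in classes G | K \subset G :\: <[s]>) #|K| = n ^ 2)%N.
  apply: prod_card_classes_uniform => //.
  - exact: subsetDl.
  - by rewrite normsD ?normG.
  - move=> x /class_notin_cycle->.
    by rewrite card_rcoset -der1_inverted_cycle card_der1_inverted_cycle.
  by rewrite cardsD (setIidPr sSG) -orderE os oG -mulnBl.
(* Each class lies in exactly one of C, <[s]> minus C and G minus <[s]>. *)
have classS x : (x ^: G \subset <[s]>) = (x \in <[s]>) by apply: class_sub_norm.
rewrite (bigID (fun K : {set gT} => K \subset <[s]>)) /=.
rewrite (bigID (fun K : {set gT} => K \subset C)) /=.
have -> : (2 ^ n.-1 * n ^ 2 = 1 ^ 2 * 2 ^ n.-1 * n ^ 2)%N.
  by rewrite exp1n mul1n.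
rewrite -prodC -prodSC -prodGS.
congr (_ * _ * _)%N; apply: eq_bigl => K; rewrite -?andbA; apply: andb_id2l;
  case/imsetP=> x Gx ->; rewrite ?classS !class_sub_norm ?normsD ?normG //.
- by apply: andb_idl; apply: (subsetP sCS).
- by rewrite in_setD andbC.
by rewrite in_setD Gx andbT.
Qed.

Lemma harada_number_inverted_cycle : harada_number G = (n ^ 2)%:R%R.
Proof.
rewrite /harada_number -natr_prod prod_card_classes_inverted_cycle.
rewrite (prod_irr1_abelian_index2 sSG (cycle_abelian s) iS (k := n.-1)).
  by rewrite natrM mulrC mulKf // pnatr_eq0 expn_eq0.
rewrite oG -divgS ?der_sub // oG card_der1_inverted_cycle mulnK //.
by rewrite -mulSn prednK // mulnC.
Qed.

End InvertedCycle.

(** * The presented group *)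

(** The relations give #[s] <= 2n and |G : <[s]>| <= 2, hence |G| <= 4n. As G
    maps onto the model, |G| >= 4n, and so both bounds are attained. *)
Lemma generalized_quaternion_inverted_cycle (n : nat) (gT : finGroupType)
    (G : {group gT}) : (2 <= n)%N -> generalized_quaternion n G ->
  exists s t, [/\ #[s] = (2 * n)%N, s \in G, #|G : <[s]>| = 2%N &
    [/\ t \in G, t \notin <[s]> & s ^ t = s^-1]].
Proof.
move=> n_gt1 presG; have n_gt0 := ltnW n_gt1.
have [hT [H [leH homH]]] := generalized_quaternion_model n_gt1.
have leG : (4 * n <= #|G|)%N.
  apply: leq_trans leH _; apply: dvdn_leq => //; apply: card_homg.
  by rewrite presG.
have /existsP[[s t] /= /eqP[defG s2n snt2 st]] := isoGrp_hom presG.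
have [Gs Gt] : s \in G /\ t \in G.
  by apply/andP; rewrite -!cycle_subG -join_subG defG.
have sSG : <[s]> \subset G by rewrite cycle_subG.
have [Ns Nt] : s \in 'N(<[s]>) /\ t \in 'N(<[s]>).
  by rewrite -!cycle_subG normG norms_cycle st groupV cycle_id.
have index_le : (#|G : <[s]>| <= 2)%N.
  have nSG : G \subset 'N(<[s]>) by rewrite -defG join_subG !cycle_subG Ns.
  rewrite -card_quotient // -defG quotientYidl ?cycle_subG // quotient_cycle //.
  rewrite -orderE dvdn_leq // order_dvdn -morphX //= -snt2.
  by rewrite coset_id ?mem_cycle.
have order_le : (#[s] <= 2 * n)%N.
  by rewrite dvdn_leq ?muln_gt0 // order_dvdn s2n.
have oG : (#[s] * #|G : <[s]>|)%N = #|G| by rewrite orderE Lagrange.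
have e4 : (4 * n = 2 * n * 2)%N by rewrite mulnAC.
have os : #[s] = (2 * n)%N.
  apply/eqP; rewrite eqn_leq order_le -(leq_pmul2r (isT : 0 < 2)%N) -e4.
  by rewrite (leq_trans leG) // -oG leq_mul.
have iS : #|G : <[s]>| = 2%N.
  apply/eqP; rewrite eqn_leq index_le -(leq_pmul2l (order_gt0 s)) oG os -e4.
  exact: leG.
exists s, t; split=> //; split=> //.
apply/negP=> St; move: iS.
by rewrite -defG (joing_idPl _) ?cycle_subG // indexgg.
Qed.

Local Close Scope group_scope.

Theorem proposition4p3 (n : nat) (gT : finGroupType) (G : {group gT}) :
  (2 <= n)%N ->
  generalized_quaternion n G ->
  harada_number G = (n ^ 2)%:R /\ (n ^ 2 = #|G^`(1)%g| ^ 2)%N.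
Proof.
move=> n_gt1 presG; have n_gt0 := ltnW n_gt1.
have [s [t [os Gs iS [Gt S't st]]]] :=
  generalized_quaternion_inverted_cycle n_gt1 presG.
split; first exact: harada_number_inverted_cycle os Gs iS Gt S't st.
by rewrite (card_der1_inverted_cycle os Gs iS Gt S't st).
Qed.
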